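(* Let $Q$ be a real symmetric $n\times n$ matrix, $c\in\mathbf{R}^n$, $A\in\mathbf{R}^{m\times n}$ with rows $A_1,\dots,A_m$, $b\in\mathbf{R}^m$, and let $X=\{x\in\mathbf{R}^n: Ax\le b\}$ be a (nonempty, bounded) polytope. Then the optimal value of the quadratic program $$\min\{x^TQx+2c^Tx:\ Ax\le b\}$$ equals the optimal value of the problem $$\begin{array}{ll}\max & \ell\\ \text{s.t.} & x^TQx+2c^Tx-\ell+\sum_{i=1}^m\alpha_i(x)(A_ix-b_i)\in P[x],\\ & \sum_{i=1}^m\alpha_i(x)(A_ix-b_i)\le 0\quad\text{for all }x\in X,\end{array}$$ where the variables are $\ell\in\mathbf{R}$ and affine functions $\alpha_1,\dots,\alpha_m:\mathbf{R}^n\to\mathbf{R}$.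
   Context: $P[x]$ denotes the set of polynomials in $x=(x_1,\dots,x_n)$ that are nonnegative on all of $\mathbf{R}^n$. $A_i$ is the $i$-th row of $A$ (a row vector). Throughout, the feasible set $X$ is assumed nonempty and bounded. *)

(* Defs.v *)
From HB Require Import structures.
From mathcomp Require Import all_boot all_order all_algebra.
From mathcomp Require Import all_classical all_reals all_analysis.
From mathcomp Require mpoly.

Set Implicit Arguments.
Unset Strict Implicit.
Unset Printing Implicit Defensive.

Import Order.TTheory GRing.Theory Num.Theory.
Import numFieldNormedType.Exports.

Local Open Scope classical_set_scope.
Local Open Scope ring_scope.

Definition polyhedron (R : realType) (m n : nat) (A : 'M[R]_(m, n))
    (b : 'cV[R]_m) : set 'cV[R]_n :=
  [set x | forall i, (row i A *m x) 0 0 <= b i 0].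

Definition quad_obj (R : realType) (n : nat) (Q : 'M[R]_n) (c x : 'cV[R]_n)
    : R :=
  (x^T *m Q *m x) 0 0 + 2 * (c^T *m x) 0 0.

(* Real polynomials are identified with the functions on R^n they induce
   (faithfully, since the field is infinite). *)
Definition polynomial_fun (R : realType) (n : nat) (f : 'cV[R]_n -> R) : Prop :=
  exists p : mpoly.mpoly n R,
    forall x, f x = mpoly.meval (fun i => x i 0) p.

Definition nonneg_polynomials (R : realType) (n : nat) : set ('cV[R]_n -> R) :=
  [set f | polynomial_fun f /\ forall x, 0 <= f x].

Definition affine_fun (R : realType) (n : nat) (f : 'cV[R]_n -> R) : Prop :=
  exists (a : 'rV[R]_n) (d : R), forall x, f x = (a *m x) 0 0 + d.

Definition multiplier_term (R : realType) (m n : nat) (A : 'M[R]_(m, n))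
    (b : 'cV[R]_m) (alpha : 'I_m -> 'cV[R]_n -> R) (x : 'cV[R]_n) : R :=
  \sum_(i < m) alpha i x * ((row i A *m x) 0 0 - b i 0).

Definition dual_feasible (R : realType) (m n : nat) (Q : 'M[R]_n)
    (c : 'cV[R]_n) (A : 'M[R]_(m, n)) (b : 'cV[R]_m)
    (l : R) (alpha : 'I_m -> 'cV[R]_n -> R) : Prop :=
  [/\ forall i, affine_fun (alpha i),
      nonneg_polynomials
        (fun x => quad_obj Q c x - l + multiplier_term A b alpha x)
    & forall x, polyhedron A b x -> multiplier_term A b alpha x <= 0].

Definition is_minimum (R : realType) (V : set R) (v : R) : Prop :=
  V v /\ lbound V v.

Definition is_maximum (R : realType) (V : set R) (v : R) : Prop :=
  V v /\ ubound V v.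

(* Main.v *)
(* The multipliers can be chosen so that the polynomial
   [q - v + \sum_i alpha_i (A_i x - b_i)] is identically zero, where [v] is the
   minimum of [q] on [X]; both constraints are then immediate.  Since [X] is
   bounded, [A] has a left inverse [B].  If [A x = b] has a solution [x0], then
   [X] is a bounded cone with apex [x0], so [X = {x0}], and [q x - q x0] is an
   affine map paired with [x - x0 = B (A x - b)].  Otherwise some [mu] satisfies
   [mu (A x - b) = 1] for all [x]; together with [x = B (A x - b) + B b] this
   writes every quadratic polynomial as [\sum_i alpha_i (A_i x - b_i)]. *)

Require Import Defs.
From HB Require Import structures.
From mathcomp Require Import all_boot all_order all_algebra.
From mathcomp Require Import all_classical all_reals all_analysis.
From mathcomp Require mpoly.
From mathcomp Require Import ring lra.

Set Implicit Arguments.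
Unset Strict Implicit.
Unset Printing Implicit Defensive.

Import Order.TTheory GRing.Theory Num.Theory.
Import numFieldNormedType.Exports.
Local Open Scope classical_set_scope.
Local Open Scope ring_scope.

Lemma norm_trmx_le (R : realDomainType) (m n : nat) (x : 'M[R]_(m, n)) :
  `|x^T| <= `|x|.
Proof.
rewrite [leLHS]/Num.norm /= [leRHS]/Num.norm /= !mx_normrE.
apply: bigmax_le => [|[i j] _]; first exact: bigmax_ge_id.
by rewrite mxE; apply/bigmax_geP; right; exists (j, i).
Qed.

Lemma scalar_trmx (R : nmodType) (x : 'M[R]_1) : x^T = x.
Proof. by apply/matrixP => i j; rewrite mxE !ord1. Qed.

Lemma row_mulmx_entry (R : pzSemiRingType) (m n : nat) (A : 'M[R]_(m, n))
    (x : 'cV[R]_n) (i : 'I_m) : (row i A *m x) 0 0 = (A *m x) i 0.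
Proof. by rewrite -row_mul mxE. Qed.

(** A nonzero such [y] is a recession direction: the ray from [x] along [y] never leaves the
    polyhedron, contradicting boundedness. *)
Lemma recession_eq0 (R : realType) (m n : nat) (A : 'M[R]_(m, n))
    (b : 'cV[R]_m) (x y : 'cV[R]_n) :
  bounded_set (polyhedron A b) -> polyhedron A b x ->
  (forall i, (A *m y) i 0 <= 0) -> y = 0.
Proof.
move=> bnd Xx Ay; apply/eqP/negPn/negP => y0.
have ny : 0 < `|y| by rewrite normr_gt0.
have [M M0 ltM] := ex_strict_bound_gt0 bnd.
(* With this [t], the norm of [t *: y] is M + |x|, so [x + t *: y] has norm at least [M], although
   [M] strictly bounds all norms on the polyhedron. *)
pose t := (M + `|x|) / `|y|.
have t0 : 0 <= t by rewrite divr_ge0 ?addr_ge0 // ltW.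
have /ltM /= : polyhedron A b (x + t *: y).
  move=> i; rewrite row_mulmx_entry.
  have -> : (A *m (x + t *: y)) i 0 = (A *m x) i 0 + t * (A *m y) i 0.
    by rewrite mulmxDr -scalemxAr !mxE.
  by have := Xx i; have := mulr_ge0_le0 t0 (Ay i); rewrite row_mulmx_entry; lra.
apply/negP; rewrite -leNgt.
have : `|t *: y| <= `|x + t *: y| + `|x|.
  by rewrite -{1}(addKr x (t *: y)) addrC; apply: le_trans (ler_normB _ _) _.
by rewrite normrZ (ger0_norm t0) divfK ?gt_eqF //; lra.
Qed.

(** The columns of [cokermx A] lie in the kernel of [A], so each is a recession direction and
    vanishes; hence [A] has full column rank. *)
Lemma bounded_polyhedron_left_inverse (R : realType) (m n : nat)
    (A : 'M[R]_(m, n)) (b : 'cV[R]_m) :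
  polyhedron A b !=set0 -> bounded_set (polyhedron A b) ->
  exists B : 'M[R]_(n, m), B *m A = 1%:M.
Proof.
move=> [x Xx] bnd; apply/row_fullP; rewrite -cokermx_eq0; apply/eqP/matrixP.
move=> i j; rewrite [RHS]mxE.
suff /matrixP/(_ i 0) : col j (cokermx A) = 0 by rewrite !mxE.
apply: (recession_eq0 bnd Xx) => k.
by rewrite colE mulmxA mulmx_coker mul0mx mxE.
Qed.

(** When [b] is outside the column space of [A], some column of [cokermx A^T] pairs with [b] to a
    nonzero [k], while [A^T] kills the row it induces. Scaling to -1 makes [mu *m (A *m x - b)]
    identically 1. *)
Lemma fredholm_alternative (F : fieldType) (m n : nat) (A : 'M[F]_(m, n)) (b : 'cV[F]_m) :
  (exists x, A *m x = b) \/
  (exists mu : 'rV[F]_m, mu *m A = 0 /\ mu *m b = (-1)%:M).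
Proof.
have [/submxP[D bD]|] := boolP (b^T <= A^T)%MS.
  by left; exists D^T; apply: trmx_inj; rewrite trmx_mul trmxK.
rewrite submxE; set K := cokermx _ => /rV0Pn[j];
set k := _ 0 j => k0; right; exists (- k^-1 *: (K *m delta_mx j (0 : 'I_1))^T).
split; rewrite -scalemxAl; [rewrite -[A]trmxK|rewrite -[b]trmxK];
  rewrite -trmx_mul mulmxA.
  by rewrite mulmx_coker mul0mx trmx0 scaler0.
apply/matrixP => i l; rewrite !ord1 -colE.
by rewrite [LHS]mxE [X in _ * X]mxE [X in _ * X]mxE -/k mulNr mulVf // !mxE.
Qed.

Lemma continuous_linear_form (R : realType) (n : nat) (a : 'rV[R]_n) :
  continuous (fun r : 'rV[R]_n => (a *m r^T) 0 0).
Proof.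
have -> : (fun r : 'rV[R]_n => (a *m r^T) 0 0) =
    (fun r => \sum_(i < n) a 0 i * r 0 i).
  by apply/funext => r; rewrite mxE; apply: eq_bigr => i _; rewrite mxE.
apply: continuous_big => [|i _ r]; first exact: add_continuous.
by apply: continuousM; [exact: cst_continuous|exact: coord_continuous].
Qed.

Lemma continuous_quad_obj_trmx (R : realType) (n : nat) (Q : 'M[R]_n)
    (c : 'cV[R]_n) : continuous (fun r : 'rV[R]_n => quad_obj Q c r^T).
Proof.
have -> : (fun r : 'rV[R]_n => quad_obj Q c r^T) =
    (fun r => \sum_(i < n) r 0 i * (row i Q *m r^T) 0 0
              + 2 * (c^T *m r^T) 0 0).
  apply/funext => r; rewrite /quad_obj trmxK -mulmxA mxE; congr (_ + _).
  by apply: eq_bigr => i _; rewrite row_mulmx_entry.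
have qcont : continuous (fun r : 'rV[R]_n =>
    \sum_(i < n) r 0 i * (row i Q *m r^T) 0 0).
  apply: continuous_big => [|i _ r]; first exact: add_continuous.
  by apply: continuousM; [exact: coord_continuous|exact: continuous_linear_form].
have lcont : continuous (fun r : 'rV[R]_n => 2 * (c^T *m r^T) 0 0).
  move=> r; apply: (@continuousM _ _ (fun=> 2)); first exact: cst_continuous.
  exact: continuous_linear_form.
by move=> r; exact: (cvgD (qcont r) (lcont r)).
Qed.

(** Extreme value theorem: a bounded intersection of closed half-spaces is compact, and the
    objective is continuous. *)
Lemma quad_obj_attains_min (R : realType) (m n : nat) (Q : 'M[R]_n)
    (c : 'cV[R]_n) (A : 'M[R]_(m, n)) (b : 'cV[R]_m) :
  polyhedron A b !=set0 -> bounded_set (polyhedron A b) ->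
  exists2 x, polyhedron A b x &
    forall y, polyhedron A b y -> quad_obj Q c x <= quad_obj Q c y.
Proof.
move=> [x0 Xx0] bnd.
(* Heine-Borel is available for row vectors only, hence the transposition. *)
pose Y := [set r : 'rV[R]_n | polyhedron A b r^T].
have Y0 : Y !=set0 by exists x0^T; rewrite /Y /= trmxK.
have Ybnd : bounded_set Y.
  have [M [Mr ltM]] := bnd; exists M; split => // N MN r Yr.
  apply: le_trans (ltM _ MN _ Yr).
  by rewrite -[leLHS]/(`|r|) -{1}[r]trmxK norm_trmx_le.
have Yclosed : closed Y.
  have -> : Y = \bigcap_(i : 'I_m)
      ((fun r : 'rV[R]_n => (row i A *m r^T) 0 0) @^-1` [set z | z <= b i 0]).
    by apply/seteqP; split => r Yr; [move=> i _; exact: Yr|move=> i; exact: Yr].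
  apply: closed_bigI => i _; apply: preimage_closed; last exact: closed_le.
  by move=> r _; exact: continuous_linear_form.
have [] := EVT_min_rV Y0 (bounded_closed_compact Ybnd Yclosed)
  (continuous_subspaceT (continuous_quad_obj_trmx (Q := Q) (c := c))).
move=> r; rewrite inE => Yr rmin; exists r^T => // y Xy.
by rewrite -[y]trmxK; apply: rmin; rewrite inE /Y /= trmxK.
Qed.

(** Negating the affine factor of the certificate gives a multiplier term equal to
    [v - quad_obj Q c x] everywhere. The polynomial is then zero, and the sign condition on the
    polyhedron is the lower bound [v]. *)
Lemma affine_multipliers (R : realType) (m n : nat) (Q : 'M[R]_n)
    (c : 'cV[R]_n) (A : 'M[R]_(m, n)) (b : 'cV[R]_m) (v : R)
    (P : 'M[R]_(m, n)) (d : 'cV[R]_m) :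
  (forall x, polyhedron A b x -> v <= quad_obj Q c x) ->
  (forall x, (quad_obj Q c x - v)%:M = (P *m x + d)^T *m (A *m x - b)) ->
  exists alpha, dual_feasible Q c A b v alpha.
Proof.
move=> vmin cert; exists (fun i x => - (P *m x + d) i 0).
have E x : multiplier_term A b (fun i x => - (P *m x + d) i 0) x =
    v - quad_obj Q c x.
  have /matrixP/(_ 0 0) := cert x.
  rewrite [LHS]mxE mulr1n [RHS]mxE -[v - _]opprB => ->.
  rewrite /multiplier_term -sumrN; apply: eq_bigr => i _.
  by rewrite row_mulmx_entry mulNr; congr (- (_ * _)); rewrite !mxE.
split.
- move=> i; exists (- row i P), (- d i 0) => x.
  by rewrite mulNmx mxE -row_mulmx_entry opprD; congr (_ + _); rewrite [RHS]mxE.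
- have Z x : quad_obj Q c x - v +
      multiplier_term A b (fun i x => - (P *m x + d) i 0) x = 0.
    by rewrite E; ring.
  by split=> [|x]; [exists (mpoly.mpolyC n 0) => x; rewrite mpoly.mevalC|]; rewrite Z.
- by move=> x Xx; rewrite E subr_le0; exact: vmin.
Qed.

Lemma quad_objE (R : realType) (n : nat) (Q : 'M[R]_n) (c x : 'cV[R]_n) :
  (quad_obj Q c x)%:M = x^T *m Q *m x + 2 *: (c^T *m x).
Proof.
rewrite /quad_obj; move: (x^T *m Q *m x) (c^T *m x) => p s.
by apply/matrixP => i j; rewrite !ord1 !mxE.
Qed.

(** By symmetry of [Q], the difference is [(Q *m x + Q *m x0 + 2 *: c)^T *m (x - x0)]; writing
    [x - x0] as [B *m (A *m x - A *m x0)] moves [B^T] into the left factor. *)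
Lemma cone_certificate (R : realType) (m n : nat) (Q : 'M[R]_n)
    (c x0 : 'cV[R]_n) (A : 'M[R]_(m, n)) (B : 'M[R]_(n, m)) :
  Q^T = Q -> B *m A = 1%:M ->
  forall x, (quad_obj Q c x - quad_obj Q c x0)%:M =
    (B^T *m Q *m x + B^T *m (Q *m x0 + 2 *: c))^T *m (A *m x - A *m x0).
Proof.
move=> Qsym BA x.
have sym : x0^T *m Q *m x = x^T *m Q *m x0.
  by rewrite -[LHS]scalar_trmx !trmx_mul Qsym trmxK mulmxA.
rewrite raddfB /= !quad_objE -[B^T *m Q *m x]mulmxA -mulmxDr trmx_mul trmxK -mulmxBr.
rewrite -[_ *m B *m _]mulmxA [B *m _]mulmxA BA mul1mx.
have -> : (Q *m x + (Q *m x0 + 2 *: c))^T = x^T *m Q + x0^T *m Q + 2 *: c^T.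
  by rewrite addrA !linearD /= linearZ /= !trmx_mul Qsym.
rewrite mulmxBr !mulmxDl -!scalemxAl sym.
move: (x^T *m Q *m x) (x^T *m Q *m x0) (x0^T *m Q *m x0) (c^T *m x) (c^T *m x0).
by move=> p q r s t; apply/matrixP => i j; rewrite !mxE; ring.
Qed.

(** Substituting [B *m (A *m x - b) + B *m b] for the right-hand [x] in the quadratic term leaves an
    affine remainder [w *m x - v], which is multiplied by 1 in the form [mu *m (A *m x - b)]. *)
Lemma unit_certificate (R : realType) (m n : nat) (Q : 'M[R]_n)
    (c : 'cV[R]_n) (A : 'M[R]_(m, n)) (b : 'cV[R]_m) (B : 'M[R]_(n, m))
    (mu : 'rV[R]_m) (v : R) :
  B *m A = 1%:M -> mu *m A = 0 -> mu *m b = (-1)%:M ->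
  forall x, (quad_obj Q c x - v)%:M =
    ((B^T *m Q^T + mu^T *m ((Q *m B *m b)^T + 2 *: c^T)) *m x
      + mu^T *m (- v)%:M)^T *m (A *m x - b).
Proof.
move=> BA muA mub x.
have mu1 : mu *m (A *m x - b) = 1%:M.
  by rewrite mulmxBr mulmxA muA mul0mx mub raddfN /= opprK add0r.
have Bx : B *m (A *m x - b) = x - B *m b by rewrite mulmxBr mulmxA BA mul1mx.
set w := (_ + 2 *: _).
have -> : ((B^T *m Q^T + mu^T *m w) *m x + mu^T *m (- v)%:M)^T =
    x^T *m Q *m B + (w *m x + (- v)%:M) *m mu.
  rewrite mulmxDl -addrA -[mu^T *m w *m x]mulmxA -mulmxDr linearD /=.
  by rewrite !trmx_mul !trmxK scalar_trmx mulmxA.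
rewrite mulmxDl -!(mulmxA _ _ (A *m x - b)) mu1 Bx mulmx1 mulmxDl -scalemxAl.
rewrite -[(Q *m B *m b)^T *m x]scalar_trmx trmx_mul trmxK mulmxBr !mulmxA.
rewrite !raddfB /= raddfN /= quad_objE.
move: (x^T *m Q *m x) (x^T *m Q *m B *m b) (c^T *m x) v%:M.
by move=> p q s t; apply/matrixP => i j; rewrite !mxE; ring.
Qed.

Theorem theorem1 (R : realType) (m n : nat) (Q : 'M[R]_n) (c : 'cV[R]_n)
    (A : 'M[R]_(m, n)) (b : 'cV[R]_m)
    (Qsym : Q^T = Q)
    (X_nonempty : polyhedron A b !=set0)
    (X_bounded : bounded_set (polyhedron A b)) :
  exists v : R,
    is_minimum [set quad_obj Q c x | x in polyhedron A b] v /\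
    is_maximum
      [set l : R | exists alpha : 'I_m -> 'cV[R]_n -> R,
                     dual_feasible Q c A b l alpha] v.
Proof.
have [xmin Xxmin xminP] := quad_obj_attains_min Q c X_nonempty X_bounded.
have [B BA] := bounded_polyhedron_left_inverse X_nonempty X_bounded.
exists (quad_obj Q c xmin); split; split.
- by exists xmin.
- by move=> _ [x Xx <-]; exact: xminP.
- have [[x0 Ax0]|[mu [muA mub]]] := fredholm_alternative A b; last first.
    exact: affine_multipliers xminP (unit_certificate _ _ _ BA muA mub).
  (* Since [A *m (xmin - x0)] equals [A *m xmin - b], which is nonpositive, [xmin - x0] is a
     recession direction and vanishes. *)
  have xmin_x0 : xmin = x0.
    have Xx0 : polyhedron A b x0 by move=> i; rewrite row_mulmx_entry Ax0.
    apply/eqP; rewrite -subr_eq0; apply/eqP.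
    apply: (recession_eq0 X_bounded Xx0) => i.
    by rewrite mulmxBr Ax0 mxE [(- b) _ _]mxE subr_le0 -row_mulmx_entry.
  have := cone_certificate c x0 Qsym BA; rewrite Ax0 -xmin_x0.
  exact: affine_multipliers xminP.
(* Weak duality: at [xmin] the polynomial is nonnegative and the multiplier term nonpositive, so [l]
   is at most the minimum. *)
- move=> l [alpha [_ [_ /(_ xmin) obj_ge0] /(_ _ Xxmin) mult_le0]].
  by lra.
Qed.
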